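(* Let $r,n,m,k$ be positive integers with $\mathrm{Sch}_k(r;n,m)\neq\emptyset$, and fix a total order on the letters $\{E,D,N\}$, with respect to which $\mathrm{maj}$ is computed. If $E>N$ in this order, then $$\sum_{P\in \mathrm{Sch}_k(r;n,m)}q^{\mathrm{maj}(P)}=\left[{n+m-r-k\atop k}\right]\left(\left[{n+m-r-2k\atop n-r-k}\right]-\left[{n+m-r-2k\atop n-k+1}\right]\right).$$ If $E<N$ in this order, then $$\sum_{P\in \mathrm{Sch}_k(r;n,m)}q^{\mathrm{maj}(P)}=\left[{n+m-r-k\atop k}\right]\left(\left[{n+m-r-2k\atop n-r-k}\right]-q^{r+1}\left[{n+m-r-2k\atop n-k+1}\right]\right).$$
   Context: A generalized Schröder path is a lattice path with steps $E=(1,0)$, $D=(1,1)$ and $N=(0,1)$ that never goes above the line $y=x$. $\mathrm{Sch}_k(r;n,m)$ denotes the set of generalized Schröder paths from $(r,0)$ to $(n,m)$ with exactly $k$ steps $D$. A path is identified with the word $P=p_1p_2\cdots p_\ell$ over $\{E,D,N\}$ recording its steps in order. For a word $P=p_1\cdots p_\ell$ over a totally ordered alphabet, $i$ (with $1\le i<\ell$) is a descent of $P$ if $p_i>p_{i+1}$, and $\mathrm{maj}(P)$ is the sum of all descents of $P$. $\left[{a\atop b}\right]$ denotes the $q$-binomial coefficient $\frac{[a]!}{[b]!\,[a-b]!}$, where $[a]=\frac{1-q^a}{1-q}$ and $[a]!=[1][2]\cdots[a]$; it is $0$ if $b<0$ or $b>a$. *)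

(* Defs.v *)
From HB Require Import structures.
From mathcomp Require Import all_boot all_order all_algebra.
From mathcomp Require Import boolp classical_sets fsbigop.

Set Implicit Arguments.
Unset Strict Implicit.
Unset Printing Implicit Defensive.

Import GRing.Theory.
Local Open Scope classical_set_scope.
Local Open Scope ring_scope.

Inductive step := East | Diag | North.

Definition nat_of_step (s : step) : nat :=
  match s with East => 0 | Diag => 1 | North => 2 end.
Definition step_of_nat (i : nat) : step :=
  match i with 0 => East | 1 => Diag | _ => North end.
Lemma nat_of_stepK : cancel nat_of_step step_of_nat.
Proof. by case. Qed.
HB.instance Definition _ := Countable.copy step (can_type nat_of_stepK).

Definition move (p : nat * nat) (s : step) : nat * nat :=
  match s with
  | East => (p.1.+1, p.2)
  | Diag => (p.1.+1, p.2.+1)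
  | North => (p.1, p.2.+1)
  end.

Definition points (p : nat * nat) (w : seq step) : seq (nat * nat) :=
  p :: scanl move p w.

(* Both endpoints of each step lie on or below y = x, hence so does the
   segment joining them: it is enough to test the lattice points. *)
Definition below_diagonal (p : nat * nat) (w : seq step) : bool :=
  all (fun z : nat * nat => z.2 <= z.1)%N (points p w).

Definition Sch (k r n m : nat) : set (seq step) :=
  [set w | [/\ foldl move (r, 0%N) w = (n, m),
               below_diagonal (r, 0%N) w
             & count_mem Diag w = k]].

Definition slt (le : rel step) : rel step := fun x y => (x != y) && le x y.

(* Descents are numbered from 1 while [nth] counts from 0, so p_i is
   [nth _ w i.-1]; the default value is never reached for 1 <= i < size w. *)
Definition descent (le : rel step) (w : seq step) (i : nat) : bool :=
  slt le (nth East w i) (nth East w i.-1).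

Definition maj (le : rel step) (w : seq step) : nat :=
  (\sum_(1 <= i < size w | descent le w i) i)%N.

Section QBinomial.
Variables (F : fieldType) (q : F).

Definition qint (a : nat) : F := (1 - q ^+ a) / (1 - q).

Definition qfact (a : nat) : F := \prod_(1 <= i < a.+1) qint i.

Definition qbinom (a b : int) : F :=
  if (0 <= b <= a) then qfact `|a|%N / (qfact `|b|%N * qfact `|a - b|%N) else 0.

End QBinomial.

Definition qvar : {fraction {poly rat}} := tofrac 'X.

(* Main.v *)
(** Deleting its diagonal steps turns a path of Sch_k(r;n,m) into a ballot word
    in E and N, and every insertion of k letters D into a ballot word arises.
    The sums over insertions and over ballot words are computed by removing the
    last letter, and both become
    tractable when one evaluates q^maj(wx) for an extra letter x instead of
    q^maj(w): by induction on l, the words w of length l obtained from u by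
    inserting letters D satisfy
      sum_w q^maj(wx) = q^(maj(ux) + [x < D] (l - |u|)) [l, |u|],
    each case of the induction being one of the two q-Pascal rules.  Likewise,
    for ballot words u with e letters E and m letters N,
      sum_u q^maj(uE) = q^([E<N] m) ([e+m, e] - [e+m, e+r+1]),
      sum_u q^maj(uN) = q^([N<E] e) ([e+m, e] - q^(r+1) [e+m, e+r+1]).
    An x which is the largest letter never creates a descent, so it gives the
    sum of q^maj itself. *)

Require Import Defs.
From mathcomp Require Import all_boot all_order all_algebra.
From mathcomp Require Import boolp classical_sets fsbigop.
From mathcomp Require Import ring zify.

Set Implicit Arguments.
Unset Strict Implicit.
Unset Printing Implicit Defensive.

Import GRing.Theory.
Local Open Scope classical_set_scope.
Local Open Scope ring_scope.

(** * Gaussian polynomials over a commutative ring, from the q-Pascal rule *)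

Fixpoint gauss (R : comPzRingType) (q : R) (a b : nat) : R :=
  match a, b with
  | _, 0 => 1
  | 0, _.+1 => 0
  | a'.+1, b'.+1 => gauss q a' b' + q ^+ b'.+1 * gauss q a' b'.+1
  end.

Section Gauss.
Variables (R : comPzRingType) (q : R).

Lemma gauss0 a : gauss q a 0 = 1.
Proof. by case: a. Qed.

Lemma gaussS a b :
  gauss q a.+1 b.+1 = gauss q a b + q ^+ b.+1 * gauss q a b.+1.
Proof. by []. Qed.

Lemma gauss_small a b : (a < b)%N -> gauss q a b = 0.
Proof.
elim: a b => [|a IHa] [|b] //; rewrite ltnS => lt_ab.
by rewrite gaussS !IHa ?mulr0 ?addr0 // ltnW.
Qed.

Lemma gaussnn a : gauss q a a = 1.
Proof. by elim: a => // a IHa; rewrite gaussS IHa gauss_small // mulr0 addr0. Qed.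

(** The dual q-Pascal rule, derived by induction without division so that it holds for every q. The
    truncated [a - b] is harmless, since [gauss q a b] vanishes for a < b. *)
Lemma gaussSr a b :
  gauss q a.+1 b.+1 = q ^+ (a - b) * gauss q a b + gauss q a b.+1.
Proof.
elim: a b => [|a IHa] [|b]; rewrite ?gauss0 //.
- by rewrite gaussS /= !expr0; ring.
- by rewrite gaussS /=; ring.
- rewrite gaussS {1}IHa [in RHS]gaussS !subn0 !gauss0 [q ^+ a.+1]exprS; ring.
have [le_ab|lt_ab] := leqP b.+1 a; last first.
  move: lt_ab; rewrite ltnS leq_eqVlt => /predU1P[->|lt_ab].
    by rewrite subnn !gaussnn (gauss_small (ltnSn _)); ring.
  by rewrite !gauss_small ?ltnS //; [ring | apply: ltnW].
(* The left side is expanded by the defining rule and then by induction, the right side by the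
   defining rule: both become the same combination of entries of row [a]. *)
rewrite gaussS {1}IHa {1}[gauss q a.+1 b.+2]IHa [gauss q a.+1 b.+1]gaussS.
rewrite [gauss q a.+1 b.+2]gaussS subSS -(subnKC le_ab) !addSn.
have -> : ((b + (a - b.+1)).+1 - b = (a - b.+1).+1)%N by lia.
have -> : ((b + (a - b.+1)).+1 - b.+1 = (a - b.+1))%N by lia.
by rewrite !exprS; ring.
Qed.

End Gauss.

Arguments gauss : simpl never.

(** * Comparison with the factorial formula when q is not a root of unity *)

Section QBinomial.
Variables (F : fieldType) (q : F).
Hypothesis q_neq1 : forall a, q ^+ a.+1 != 1.

Lemma qfactS a : qfact q a.+1 = qfact q a * qint q a.+1.
Proof. by rewrite /qfact big_nat_recr. Qed.

Lemma qint_neq0 a : qint q a.+1 != 0.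
Proof.
have q1 : 1 - q != 0 by rewrite subr_eq0 eq_sym -(expr1 q).
by rewrite mulf_neq0 ?invr_eq0 // subr_eq0 eq_sym.
Qed.

Lemma qfact_neq0 a : qfact q a != 0.
Proof.
elim: a => [|a IHa]; first by rewrite /qfact big_nil oner_eq0.
by rewrite qfactS mulf_neq0 ?qint_neq0.
Qed.

(** By induction on a + b, through [a+1] + q^(a+1) [b+1] = [a+b+2]. *)
Lemma gauss_qfact a b :
  gauss q (a + b) a * (qfact q a * qfact q b) = qfact q (a + b).
Proof.
have qfact0 : qfact q 0 = 1 by rewrite /qfact big_nil.
move: {2}(a + b)%N (erefl (a + b)%N) => s.
elim: s a b => [|s IHs] [|a] [|b] // Es;
  rewrite ?addn0 ?gauss0 ?gaussnn ?qfact0 ?mul1r ?mulr1 //.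
have := IHs a.+1 b; have := IHs a b.+1; rewrite !addnS !addSn => IH1 IH2.
have {}IH1 := IH1 (ltac:(lia)); have {}IH2 := IH2 (ltac:(lia)).
rewrite gaussS mulrDl {1}(qfactS a) (qfactS b) (qfactS (a + b).+1).
transitivity (qint q a.+1 * (gauss q (a + b).+1 a * (qfact q a * qfact q b.+1))
  + q ^+ a.+1 * qint q b.+1 * (gauss q (a + b).+1 a.+1 * (qfact q a.+1 * qfact q b))).
  by rewrite (qfactS b); ring.
rewrite IH1 IH2 -mulrDl mulrC; congr (_ * _).
rewrite /qint mulrA -mulrDl; congr (_ / _).
by rewrite -addnS -addSn exprD; ring.
Qed.

Lemma qbinom_gauss a b : qbinom q a%:Z b%:Z = gauss q a b.
Proof.
rewrite /qbinom !lez_nat leq0n /=; case: leqP => [le_ba|]; last first.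
  by move=> lt_ab; rewrite gauss_small.
have -> : `|a%:Z - b%:Z|%N = (a - b)%N by lia.
have := gauss_qfact b (a - b); rewrite subnKC // => <-.
by rewrite mulfK // mulf_neq0 ?qfact_neq0.
Qed.

(** Invisible in the recursion, but clear from the factorial formula. It makes the ballot polynomial
    vanish just above the diagonal, and it trades the lower index k of the first factor for e +
    m. *)
Lemma gauss_sym a b : gauss q (a + b) a = gauss q (a + b) b.
Proof.
have ab0 : qfact q a * qfact q b != 0 by rewrite mulf_neq0 ?qfact_neq0.
by apply: (mulIf ab0); rewrite gauss_qfact (mulrC (qfact q a)) addnC gauss_qfact.
Qed.

End QBinomial.

Lemma expr_qvar_neq1 a : qvar ^+ a.+1 != 1.
Proof.
rewrite /qvar -tofracXn -tofrac1 tofrac_eq; apply/eqP => /(congr1 (size : {poly rat} -> nat)).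
by rewrite size_polyXn size_poly1.
Qed.

(** * Words of fixed length, built by appending a last letter *)

Fixpoint words (T : eqType) (A : seq T) (l : nat) : seq (seq T) :=
  if l is l'.+1 then [seq rcons w y | y <- A, w <- words A l'] else [:: [::]].

Section Words.
Variables (T : eqType) (A : seq T).

Lemma mem_words l w : (w \in words A l) = (size w == l) && all (mem A) w.
Proof.
elim: l w => [|l IHl] w; first by case: w.
case/lastP: w => [|w y].
  by apply/negbTE/allpairsP => -[[y w] [/= _ _]]; case: w.
rewrite size_rcons eqSS all_rcons.
apply/allpairsP/and3P => [[[z v] /= [Az]]|[sw Ay Aw]].
  by rewrite IHl => /andP[sv Av] /rcons_inj[-> ->].
by exists (y, w); split=> //=; rewrite IHl sw.
Qed.

Lemma words_uniq l : uniq A -> uniq (words A l).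
Proof.
move=> uA; elim: l => //= l IHl; apply: allpairs_uniq => //.
by move=> [y w] [z v] _ _ /= /rcons_inj[-> ->].
Qed.

Lemma big_words_rcons (R : nmodType) l (P : pred (seq T)) (f : seq T -> R) :
  \sum_(w <- words A l.+1 | P w) f w =
  \sum_(y <- A) \sum_(w <- words A l | P (rcons w y)) f (rcons w y).
Proof.
rewrite big_mkcond big_allpairs_dep; apply: eq_bigr => y _.
by rewrite -big_mkcond.
Qed.

End Words.

(** * The major index after appending a letter *)

Section Maj.
Variable le : rel step.

(** Only position [size w] can become a new descent. For empty [w] the default of [last] does not
    matter, as that position has weight 0. *)
Lemma maj_rcons w x :
  maj le (rcons w x) = (maj le w + slt le x (last x w) * size w)%N.
Proof.
case/lastP: w => [|w y]; first by rewrite /maj !big_geq // muln0.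
rewrite last_rcons /maj !size_rcons big_mkcond big_nat_recr //=.
rewrite [in RHS]big_mkcond /=; congr (_ + _)%N.
  apply: eq_big_nat => i; rewrite ltnS => /andP[i_gt0 le_iw].
  rewrite /descent nth_rcons size_rcons ltnS le_iw.
  by rewrite [nth _ _ i.-1]nth_rcons size_rcons ltnS (leq_trans (leq_pred i)).
rewrite /descent nth_rcons size_rcons ltnn eqxx nth_rcons size_rcons leqnn.
by rewrite nth_rcons ltnn eqxx; case: slt; rewrite ?mul1n ?mul0n.
Qed.

Lemma maj_rcons2 w y x :
  maj le (rcons (rcons w y) x) = (maj le (rcons w y) + slt le x y * (size w).+1)%N.
Proof. by rewrite maj_rcons last_rcons size_rcons. Qed.

End Maj.

(** * The strict order on the three steps *)

Section StrictOrder.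
Variable le : rel step.
Hypotheses (le_anti : antisymmetric le) (le_trans : transitive le).
Hypothesis le_total : total le.

Lemma sltxx x : slt le x x = false.
Proof. by rewrite /slt eqxx. Qed.

Lemma slt_trans : transitive (slt le).
Proof.
move=> y x z /andP[xy le_xy] /andP[yz le_yz]; rewrite /slt (le_trans le_xy le_yz) andbT.
by apply: contra_neq xy => xz; apply: le_anti; rewrite le_xy xz.
Qed.

Lemma sltNge x y : x != y -> slt le x y = ~~ slt le y x.
Proof.
rewrite /slt [y == x]eq_sym => /[dup] xy -> /=.
case: (boolP (le x y)) => [le_xy|]; last by case/orP: (le_total x y) => ->.
by symmetry; apply: contra_neqN xy => le_yx; apply: le_anti; rewrite le_xy.
Qed.

Lemma exists_max_step : exists t, forall y, slt le t y = false.
Proof.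
have le_refl x : le x x by case/orP: (le_total x x).
have [t tmax] : exists t, forall y, le y t.
  have [ED|DE] := orP (le_total East Diag).
    have [DN|ND] := orP (le_total Diag North); [exists North | exists Diag];
      case=> //; exact: le_trans DN.
  have [EN|NE] := orP (le_total East North); [exists North | exists East];
    case=> //; exact: le_trans EN.
exists t => y; apply/negbTE/negP => /andP[/eqP ty le_ty]; apply: ty.
by apply: le_anti; rewrite le_ty tmax.
Qed.

End StrictOrder.

(** * Insertion of diagonal steps *)

Section Sums.
Variables (R : comPzRingType) (q : R) (le : rel step).

(** All words summed over have length l, so a descent from y to x always sits at position l + 1 and
    contributes a constant factor. *)
Lemma sum_maj_rcons2 A l (P : pred (seq step)) y x :
  \sum_(w <- words A l | P w) q ^+ maj le (rcons (rcons w y) x) =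
  q ^+ (slt le x y * l.+1) * \sum_(w <- words A l | P w) q ^+ maj le (rcons w y).
Proof.
rewrite mulr_sumr big_seq_cond [RHS]big_seq_cond; apply: eq_bigr => w.
rewrite mem_words => /andP[/andP[/eqP sw _] _].
by rewrite maj_rcons2 sw exprD mulrC.
Qed.

Hypotheses (le_anti : antisymmetric le) (le_trans : transitive le).
Hypothesis le_total : total le.

(** The induction step for insertions into a word ua with |u| = L, after division by q^maj(ua): the
    first summand comes from the words ending in D, the second from those ending in a. *)
Lemma maj_shuffle_step l L a x : a != Diag ->
  q ^+ (slt le x Diag * l.+1) * (q ^+ (slt le Diag a * L.+1) * gauss q l L.+1) +
  q ^+ (slt le x a * l.+1) * (q ^+ (slt le a Diag * (l - L)) * gauss q l L) =
  q ^+ (slt le x a * L.+1 + slt le x Diag * (l - L)) * gauss q l.+1 L.+1.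
Proof.
move=> aD; have [lt_lL|le_Ll] := ltnP l L.
  by rewrite !gauss_small ?ltnS ?(ltnW lt_lL) // !mulr0 addr0.
(* Transitivity excludes two of the eight truth assignments to x < a, x < D, D < a; three of the
   other six use [gaussS], three use [gaussSr]. *)
have sub1 : slt le x a -> slt le a Diag -> slt le x Diag by exact: slt_trans.
have sub2 : slt le x Diag -> slt le Diag a -> slt le x a by exact: slt_trans.
have el : l.+1 = (L.+1 + (l - L))%N by rewrite addSn subnKC.
move: sub1 sub2; rewrite (sltNge le_anti le_total aD).
case: (slt le x a); case: (slt le x Diag); case: (slt le Diag a) => //= sub1 sub2;
  try (by have := sub1 isT isT); try (by have := sub2 isT isT);
  rewrite ?mul1n ?mul0n ?addn0 ?add0n ?expr0 ?mul1r.
- by rewrite gaussS el exprD; ring.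
- by rewrite gaussSr el exprD; ring.
- by rewrite gaussSr el exprD; ring.
- by rewrite gaussS el exprD; ring.
- by rewrite gaussS; ring.
- by rewrite gaussSr; ring.
Qed.

Lemma sum_maj_shuffle l u x : all (predC1 Diag) u ->
  \sum_(w <- words [:: East; Diag; North] l | filter (predC1 Diag) w == u)
     q ^+ maj le (rcons w x) =
  q ^+ (maj le (rcons u x) + slt le x Diag * (l - size u)) * gauss q l (size u).
Proof.
elim: l u x => [|l IHl] u x Du.
  rewrite big_mkcond big_seq1 sub0n muln0 addn0 /=.
  by case: u {Du} => [|y u] /=; rewrite ?mulr1 ?mulr0.
rewrite big_words_rcons !big_cons big_nil addr0 !sum_maj_rcons2.
have pD y : \sum_(w <- words [:: East; Diag; North] l |
    filter (predC1 Diag) (rcons w Diag) == u) q ^+ maj le (rcons w y) =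
  \sum_(w <- words [:: East; Diag; North] l |
    filter (predC1 Diag) w == u) q ^+ maj le (rcons w y).
  by apply: eq_bigl => w; rewrite filter_rcons.
rewrite pD (IHl u) // sltxx mul0n addn0.
case/lastP: u Du {pD} => [|u a] Du.
  rewrite !(big_pred0 _ _ _ (fun w => _)) => [|w|w];
    try by rewrite filter_rcons -size_eq0 size_rcons.
  rewrite /= !gauss0 !mulr1 !mulr0 addr0 add0r -exprD subn0; congr (_ ^+ _).
  by rewrite !(maj_rcons _ [::]) /= !muln0 addnC.
move: Du; rewrite all_rcons => /andP[aD Du]; rewrite size_rcons subSS.
(* A word ending in E or N can reduce to [rcons u a] only if its last letter is a; the indicator
   treats both letters at once. *)
have pN y : y != Diag ->
  \sum_(w <- words [:: East; Diag; North] l |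
    filter (predC1 Diag) (rcons w y) == rcons u a) q ^+ maj le (rcons w y) =
  (a == y)%:R * (q ^+ (maj le (rcons u a) + slt le a Diag * (l - size u))
     * gauss q l (size u)).
  move=> yD; have [->|ay] := eqVneq a y.
    rewrite mul1r -IHl //; apply: eq_bigl => w.
    by rewrite filter_rcons /= yD eqseq_rcons eqxx andbT.
  rewrite mul0r big_pred0 // => w.
  by rewrite filter_rcons /= yD eqseq_rcons [y == a]eq_sym (negPf ay) andbF.
rewrite !pN // !maj_rcons2 !exprD -!mulrA.
have := maj_shuffle_step l (size u) x aD; rewrite exprD -!mulrA => <-.
by move: aD; case: a {Du pN} => //= _; ring.
Qed.

Lemma sum_maj_shuffle_total l u : all (predC1 Diag) u ->
  \sum_(w <- words [:: East; Diag; North] l | filter (predC1 Diag) w == u)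
     q ^+ maj le w = q ^+ maj le u * gauss q l (size u).
Proof.
move=> Du; have [t tmax] := exists_max_step le_anti le_trans le_total.
have maj_t w : maj le w = maj le (rcons w t) by rewrite maj_rcons tmax addn0.
under eq_bigr do rewrite maj_t.
by rewrite sum_maj_shuffle // tmax addn0 -maj_t.
Qed.

End Sums.

(** * Endpoints, the diagonal condition and deletion of diagonal steps *)

Lemma foldl_move p w :
  foldl move p w = (p.1 + (count_mem East w + count_mem Diag w),
                    p.2 + (count_mem North w + count_mem Diag w))%N.
Proof.
elim: w p => [|[] w IHw] p /=; rewrite ?IHw /=; first by rewrite !addn0; case: p.
all: by congr pair; lia.
Qed.

Lemma below_diagonal_rcons p w y : below_diagonal p (rcons w y) =
  below_diagonal p w && ((foldl move p (rcons w y)).2 <= (foldl move p (rcons w y)).1)%N.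
Proof. by rewrite /below_diagonal /points scanl_rcons -rcons_cons all_rcons andbC. Qed.

Lemma below_diagonal_last p w :
  below_diagonal p w -> ((foldl move p w).2 <= (foldl move p w).1)%N.
Proof.
case/lastP: w => [|w y]; first by rewrite /below_diagonal /= andbT.
by rewrite below_diagonal_rcons => /andP[].
Qed.

Lemma count_mem_filter_Diag y w :
  count_mem y (filter (predC1 Diag) w) = ((y != Diag) * count_mem y w)%N.
Proof.
rewrite count_filter; have [->|yD] := eqVneq y Diag.
  by rewrite mul0n -(count_pred0 w); apply: eq_count => z /=; rewrite andbN.
rewrite mul1n; apply: eq_count => z /=.
by case: eqVneq => // ->; rewrite yD.
Qed.

(** A diagonal step preserves the difference of the coordinates, so deleting it does not affect on
    which side of y = x the other points lie. *)
Lemma below_diagonal_filter p w :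
  below_diagonal p (filter (predC1 Diag) w) = below_diagonal p w.
Proof.
elim/last_ind: w => // w y IHw.
rewrite filter_rcons; case: ifP => [yD|/negbFE/eqP->]; last first.
  rewrite below_diagonal_rcons IHw foldl_rcons /= ltnS.
  by case: (boolP (below_diagonal p w)) => //= /below_diagonal_last ->.
rewrite !below_diagonal_rcons IHw !foldl_rcons !foldl_move !count_mem_filter_Diag.
by congr (_ && _); case: y yD => //= _; lia.
Qed.

(** * Ballot words and their generating functions *)

Definition ballot (r e m : nat) (u : seq step) : bool :=
  [&& count_mem East u == e, count_mem North u == m & below_diagonal (r, 0%N) u].

Section Ballot.
Variables (R : comPzRingType) (q : R) (r : nat).

(** At q = c = 1 this is the count given by the reflection principle. The values c = 1 and c =
    q^(r+1) correspond to an appended E and an appended N. *)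
Definition ballot_poly (c : R) (e m : nat) : R :=
  gauss q (e + m) e - c * gauss q (e + m) (e + r.+1).

(** Both terms are split by [gaussSr], with powers q^(m+1) and q^(m-r); their ratio q^(r+1) is what
    turns c = q^(r+1) into c = 1. *)
Lemma ballot_poly_rec1 e m : ballot_poly (q ^+ r.+1) e.+1 m.+1 =
  q ^+ m.+1 * ballot_poly 1 e m.+1 + ballot_poly (q ^+ r.+1) e.+1 m.
Proof.
rewrite /ballot_poly !addnS !addSn (gaussSr q (e + m).+1 e).
rewrite (gaussSr q (e + m).+1 (e + r).+1).
have -> : ((e + m).+1 - e = m.+1)%N by lia.
have -> : ((e + m).+1 - (e + r).+1 = m - r)%N by lia.
(* For m < r the truncated exponent multiplies a Gaussian polynomial that is zero. *)
have [le_rm|lt_mr] := leqP r m; last first.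
  by rewrite [gauss q (e + m).+1 (e + r).+1]gauss_small ?ltnS ?ltn_add2l //; ring.
have -> : q ^+ m.+1 = q ^+ r.+1 * q ^+ (m - r) by rewrite -exprD addSn subnKC.
ring.
Qed.

(** Dually, by [gaussS]: the power q^(e+r+2) = q^(e+1) q^(r+1) turns c = 1 into c = q^(r+1). *)
Lemma ballot_poly_rec2 e m : ballot_poly 1 e.+1 m.+1 =
  ballot_poly 1 e m.+1 + q ^+ e.+1 * ballot_poly (q ^+ r.+1) e.+1 m.
Proof.
rewrite /ballot_poly !addnS !addSn (gaussS q (e + m).+1 e).
by rewrite (gaussS q (e + m).+1 (e + r).+1) !exprS exprD; ring.
Qed.

Lemma ballot_poly0r c e : ballot_poly c e 0 = 1.
Proof. by rewrite /ballot_poly addn0 gaussnn gauss_small ?mulr0 ?subr0 //; lia. Qed.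

Lemma ballot_poly0l c m : (m <= r)%N -> ballot_poly c 0 m = 1.
Proof. by move=> le_mr; rewrite /ballot_poly !add0n gauss0 gauss_small // mulr0 subr0. Qed.

Variable le : rel step.

Definition ballot_sum (x : step) (e m : nat) : R :=
  \sum_(u <- words [:: East; North] (e + m) | ballot r e m u) q ^+ maj le (rcons u x).

Lemma ballot_sum_out x e m : (r + e < m)%N -> ballot_sum x e m = 0.
Proof.
move=> lt_m; rewrite /ballot_sum big_seq_cond big_pred0 // => u.
apply/negbTE/negP => /and4P[_ /eqP cE /eqP cN /below_diagonal_last].
by rewrite foldl_move cE cN /=; lia.
Qed.

Lemma ballot_sum00 x : ballot_sum x 0 0 = 1.
Proof. by rewrite /ballot_sum /= big_mkcond big_seq1 /= /maj big_geq. Qed.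

(** As m <= r + e keeps the endpoint on or below the diagonal, only the condition on the prefix [u]
    remains. *)
Lemma ballot_rcons e m u y l : u \in words [:: East; North] l ->
  (m <= r + e)%N ->
  ballot r e m (rcons u y) =
  match y with
  | East => (0 < e)%N && ballot r e.-1 m u
  | North => (0 < m)%N && ballot r e m.-1 u
  | Diag => ballot r e m (rcons u y)
  end.
Proof.
rewrite mem_words => /andP[_ Au] le_m.
have cD : count_mem Diag u = 0%N.
  by apply/count_memPn/negP => /(allP Au).
rewrite /ballot below_diagonal_rcons foldl_move -cats1 !count_cat /= cD.
case: y => //=; rewrite ?addn0 ?add0n ?addn1.
  case: e le_m => [|e] le_m; first by [].
  rewrite eqSS /=; case: eqP => //= ->; case: eqP => //= ->.
  by rewrite andb_idr // => _; lia.
case: m le_m => [|m] le_m; first by rewrite andbF.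
rewrite eqSS /=; case: eqP => //= ->; case: eqP => //= ->.
by rewrite andb_idr // => _; lia.
Qed.

Lemma ballot_sum_rec x e m : (0 < e + m)%N -> (m <= r + e)%N ->
  ballot_sum x e m =
  (if e is e'.+1 then q ^+ (slt le x East * (e + m)) * ballot_sum East e' m else 0) +
  (if m is m'.+1 then q ^+ (slt le x North * (e + m)) * ballot_sum North e m' else 0).
Proof.
move=> em le_m; rewrite /ballot_sum; case El: (e + m)%N em => [//|l] _.
rewrite big_words_rcons !big_cons big_nil addr0 !sum_maj_rcons2; congr (_ + _).
  case: e El le_m => [|e] El le_m.
    rewrite big_seq_cond big_pred0 ?mulr0 // => u.
    by apply/negbTE/andP => -[/ballot_rcons ->].
  have -> : (e + m = l)%N by lia.
  congr (_ * _); rewrite big_seq_cond [RHS]big_seq_cond; apply: eq_bigl => u.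
  by case: (boolP (u \in _)) => //= /ballot_rcons ->.
case: m El le_m => [|m] El le_m.
  rewrite big_seq_cond big_pred0 ?mulr0 // => u.
  by apply/negbTE/andP => -[/ballot_rcons ->].
have -> : (e + m = l)%N by lia.
congr (_ * _); rewrite big_seq_cond [RHS]big_seq_cond; apply: eq_bigl => u.
by case: (boolP (u \in _)) => //= /ballot_rcons ->.
Qed.

(** An instance of symmetry: e and e + r + 1 are complementary in row 2e + r + 1. It is assumed
    while the ring is arbitrary and discharged at [qvar] by [gauss_sym]. *)
Hypothesis ballot_poly_boundary : forall e, ballot_poly 1 e (r + e).+1 = 0.

(* Points with m = r + e + 1 lie just above the diagonal; there both sides of
   the first identity vanish. *)
Lemma ballot_sumE e m : slt le North East = ~~ slt le East North ->
  ((m <= (r + e).+1)%N ->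
     ballot_sum East e m = q ^+ (slt le East North * m) * ballot_poly 1 e m) /\
  ((m <= r + e)%N ->
     ballot_sum North e m = q ^+ (slt le North East * e) * ballot_poly (q ^+ r.+1) e m).
Proof.
move=> NE; move: {2}(e + m)%N (erefl (e + m)%N) => l.
elim: l e m => [|l IHl] e m El.
  have [-> ->] : e = 0%N /\ m = 0%N by lia.
  by rewrite !ballot_sum00 !ballot_poly0r !muln0 !expr0 !mulr1.
suff rec : (m <= r + e)%N ->
    ballot_sum East e m = q ^+ (slt le East North * m) * ballot_poly 1 e m /\
    ballot_sum North e m = q ^+ (slt le North East * e) * ballot_poly (q ^+ r.+1) e m.
  split=> [|/rec[]//]; rewrite leq_eqVlt => /predU1P[->|/rec[]//].
  by rewrite ballot_sum_out // ballot_poly_boundary mulr0.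
move=> le_m; rewrite !ballot_sum_rec ?El // NE !sltxx !mul0n !expr0.
case: e El le_m => [|e] El le_m.
  case: m El le_m => // m [El] le_m; rewrite (IHl 0%N m El).2; last by lia.
  rewrite !ballot_poly0l -?El; [|lia..].
  by rewrite !add0r !muln0 expr0 !mul1r mulr1.
(* Removing a final E from a word ending on the diagonal gives m = r + e + 1; hence the wider bound
   in the first identity. *)
rewrite (IHl e m _).1; [|lia..].
case: m El le_m => [|m] El le_m.
  by rewrite !ballot_poly0r !muln0 -El addn0; split; ring.
rewrite (IHl e.+1 m _).2; [|lia..].
rewrite ballot_poly_rec1 ballot_poly_rec2 -El NE.
by case: slt; rewrite /= ?mul0n ?mul1n ?expr0 ?mul1r; split;
  rewrite ?exprD; ring.
Qed.

End Ballot.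

(** * From ballot words to Schröder paths *)

Section SchroderSum.
Variables (R : comPzRingType) (q : R) (r : nat) (le : rel step).
Hypotheses (le_anti : antisymmetric le) (le_trans : transitive le).
Hypothesis le_total : total le.
Hypothesis ballot_poly_boundary : forall e, ballot_poly q r 1 e (r + e).+1 = 0.

(** The appended letter is the larger of E and N, which creates no descent in a word without D,
    whatever the rank of D; this choice determines c. *)
Lemma sum_maj_ballot e m : (m <= r + e)%N ->
  \sum_(u <- words [:: East; North] (e + m) | ballot r e m u) q ^+ maj le u =
  ballot_poly q r (if slt le East North then q ^+ r.+1 else 1) e m.
Proof.
move=> le_m; have NE : slt le North East = ~~ slt le East North by exact: sltNge.
have [sumE sumN] := ballot_sumE ballot_poly_boundary e m NE.
have maj_t t u : (forall y, y != Diag -> slt le t y = false) ->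
    all (mem [:: East; North]) u -> maj le (rcons u t) = maj le u.
  move=> tmax; case/lastP: u => [|u y]; first by rewrite /maj !big_geq.
  rewrite all_rcons maj_rcons last_rcons => /andP[yA _].
  by rewrite tmax ?addn0 //; case: y yA.
have sum_t t : (forall y, y != Diag -> slt le t y = false) ->
    \sum_(u <- words [:: East; North] (e + m) | ballot r e m u) q ^+ maj le u =
    ballot_sum q r le t e m.
  move=> tmax; rewrite /ballot_sum big_seq_cond [RHS]big_seq_cond.
  apply: eq_bigr => u /andP[+ _]; rewrite mem_words => /andP[_ Au].
  by rewrite maj_t.
case: ifP NE sumE sumN => EN NE sumE sumN.
  by rewrite (sum_t North) ?sumN ?NE ?mul0n ?mul1r // => -[] // _; rewrite ?NE ?sltxx.
by rewrite (sum_t East) ?sumE ?EN ?mul0n ?mul1r ?leqW // => -[] // _; rewrite ?sltxx.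
Qed.

Lemma size_steps w :
  size w = (count_mem East w + count_mem North w + count_mem Diag w)%N.
Proof. by elim: w => //= -[] w ->; do 3![case: eqP => // _]; lia. Qed.

Lemma mem_Sch e m k w : Sch k r (r + e + k) (m + k) w <->
  w \in [seq w <- words [:: East; Diag; North] (e + m + k) |
           ballot r e m (filter (predC1 Diag) w)].
Proof.
have Aw : all (mem [:: East; Diag; North]) w by apply/allP => -[].
rewrite mem_filter mem_words Aw andbT size_steps /ballot below_diagonal_filter.
rewrite !count_mem_filter_Diag !mul1n /Sch /= foldl_move.
split=> [[[/= eqE eqN] -> eqD]|/andP[/and3P[/eqP -> /eqP -> ->] /eqP eqD]].
  by rewrite !andbT; apply/andP; split; [apply/andP; split|]; apply/eqP; lia.
by split=> //=; [congr pair|]; lia.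
Qed.

Lemma sum_maj_Sch e m k : (m <= r + e)%N ->
  \sum_(P \in Sch k r (r + e + k) (m + k)) q ^+ maj le P =
  gauss q (e + m + k) (e + m) *
    ballot_poly q r (if slt le East North then q ^+ r.+1 else 1) e m.
Proof.
move=> le_m; set A := [:: East; Diag; North]; set l := (e + m + k)%N.
(* The paths are the entries of a duplicate-free list, so the sum over a set becomes a sum over that
   list. *)
have -> : Sch k r (r + e + k) (m + k) =
    [set` [seq w <- words A l | ballot r e m (filter (predC1 Diag) w)]].
  by apply/seteqP; split=> w /mem_Sch.
rewrite -fsbig_seq ?filter_uniq ?words_uniq // big_filter -sum_maj_ballot // mulr_sumr.
(* Paths are grouped by the word [v] left after deleting D, which occurs exactly once among the
   words of length e + m. *)
transitivity (\sum_(u <- words [:: East; North] (e + m) | ballot r e m u)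
    \sum_(w <- words A l | filter (predC1 Diag) w == u) q ^+ maj le w).
  rewrite (exchange_big_dep predT) //= big_mkcond; apply: eq_bigr => w _.
  set v := [seq x <- w | predC1 Diag x].
  case: ifP => bv; last first.
    by rewrite big_pred0 // => u; case: eqP => [<-|]; rewrite ?bv ?andbF.
  have vA : v \in words [:: East; North] (e + m).
    rewrite mem_words; have Av : all (mem [:: East; North]) v.
      by apply/allP => -[]; rewrite ?mem_filter.
    rewrite Av andbT size_steps [X in (_ + X)%N]count_mem_filter_Diag eqxx mul0n addn0.
    by case/and3P: bv => /eqP-> /eqP->.
  rewrite -big_filter (eq_in_filter (a2 := pred1 v)) => [|u _].
    by rewrite filter_pred1_uniq ?words_uniq // big_seq1.
  by rewrite /= [v == u]eq_sym; case: eqP => [->|]; rewrite ?bv ?andbF.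
rewrite big_seq_cond [RHS]big_seq_cond; apply: eq_bigr => u.
rewrite mem_words => /andP[/andP[/eqP su Au] _].
rewrite sum_maj_shuffle_total //; last by apply: sub_all Au => -[].
by rewrite su mulrC.
Qed.

End SchroderSum.

Theorem theorem1p1 (r n m k : nat) (le : rel step)
    (r_gt0 : (0 < r)%N) (n_gt0 : (0 < n)%N) (m_gt0 : (0 < m)%N)
    (k_gt0 : (0 < k)%N)
    (Sch_neq0 : Sch k r n m !=set0)
    (le_refl : reflexive le) (le_anti : antisymmetric le)
    (le_trans : transitive le) (le_total : total le) :
  (slt le North East ->
     \sum_(P \in Sch k r n m) qvar ^+ maj le P =
     qbinom qvar (n%:Z + m%:Z - r%:Z - k%:Z) k%:Z *
     (qbinom qvar (n%:Z + m%:Z - r%:Z - 2 * k%:Z) (n%:Z - r%:Z - k%:Z)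
      - qbinom qvar (n%:Z + m%:Z - r%:Z - 2 * k%:Z) (n%:Z - k%:Z + 1))) /\
  (slt le East North ->
     \sum_(P \in Sch k r n m) qvar ^+ maj le P =
     qbinom qvar (n%:Z + m%:Z - r%:Z - k%:Z) k%:Z *
     (qbinom qvar (n%:Z + m%:Z - r%:Z - 2 * k%:Z) (n%:Z - r%:Z - k%:Z)
      - qvar ^+ r.+1 *
        qbinom qvar (n%:Z + m%:Z - r%:Z - 2 * k%:Z) (n%:Z - k%:Z + 1))).
Proof.
(* Counting the steps of one path gives n = r + e + k and m = m' + k with m' <= r + e, so every
   integer argument becomes a natural number. *)
case: Sch_neq0 => w [+ /below_diagonal_last + wD].
rewrite foldl_move /= wD add0n => -[en em] le_wEN.
set e := count_mem East w in en le_wEN; set m' := count_mem North w in em le_wEN.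
have {en}-> : n = (r + e + k)%N by rewrite -en addnA.
rewrite -{}em {m m_gt0}; have {}le_wEN : (m' <= r + e)%N by lia.
have -> : ((r + e + k)%:Z + (m' + k)%:Z - r%:Z - k%:Z = (e + m' + k)%N)%R by lia.
have -> : ((r + e + k)%:Z + (m' + k)%:Z - r%:Z - 2 * k%:Z = (e + m')%N)%R by lia.
have -> : ((r + e + k)%:Z - r%:Z - k%:Z = e)%R by lia.
have -> : ((r + e + k)%:Z - k%:Z + 1 = (e + r.+1)%N)%R by lia.
rewrite !(qbinom_gauss expr_qvar_neq1) -(gauss_sym expr_qvar_neq1) sum_maj_Sch //; last first.
  move=> i; have -> : (r + i).+1 = (i + r.+1)%N by lia.
  by rewrite /ballot_poly mul1r (gauss_sym expr_qvar_neq1 i) subrr.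
split=> [NE|->//]; rewrite (sltNge le_anti le_total) // NE /=.
by rewrite /ballot_poly mul1r.
Qed.
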